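(* If $K$ is a compact Hausdorff space with $|K''|\geq 2$, then there is an isometric SPR embedding $T:C[1,\omega^2]\to C(K)$; that is, a linear isometric embedding $T$ whose image $T(C[1,\omega^2])$ does stable phase retrieval in $C(K)$.
   Context: Scalars are real. For a compact Hausdorff space $K$, $C(K)$ is the Banach lattice of real continuous functions on $K$ with the sup norm and pointwise order. $K'$ is the set of non-isolated points of $K$ and $K''=(K')'$ is the second Cantor--Bendixson derivative. $[1,\omega^2]$ is the set of ordinals $\beta$ with $1\le\beta\le\omega^2$ with the order topology, a compact Hausdorff space, and $C[1,\omega^2]$ denotes $C([1,\omega^2])$. A linear subspace $E$ of a Banach lattice $X$ does $C$-stable phase retrieval ($C$-SPR) if $\min_{|\lambda|=1}\|x-\lambda y\|\leq C\,\||x|-|y|\|$ for all $x,y\in E$ (the minimum being over unimodular scalars $\lambda$, i.e. $\lambda=\pm1$); it does stable phase retrieval (SPR) if it does $C$-SPR for some constant $C\geq1$. *)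

(* Defs.v *)
From HB Require Import structures.
From mathcomp Require Import all_boot all_order all_algebra.
From mathcomp Require Import all_classical all_reals all_analysis.
Import Order.TTheory GRing.Theory Num.Theory.
Import numFieldNormedType.Exports.

Set Implicit Arguments.
Unset Strict Implicit.
Unset Printing Implicit Defensive.

Local Open Scope classical_set_scope.
Local Open Scope ring_scope.

HB.mixin Record isCompactHausdorff K & Topological K := {
  compactT : compact [set: K];
  hausdorffT : hausdorff_space K
}.

#[short(type="compactHausdorffType")]
HB.structure Definition CompactHausdorff :=
  { K of isCompactHausdorff K & Topological K }.

(* The points of [A] that are not isolated in [A]: [A'] for the subspace [A]. *)
Definition cantor_bendixson (K : topologicalType) (A : set K) : set K :=
  A `\` isolated A.

Definition contfun (R : realType) (K : compactHausdorffType) : Type :=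
  continuousType K R.

Definition contfun_fun (R : realType) (K : compactHausdorffType)
    (f : contfun R K) : K -> R := Continuous.sort (f : continuousType K R).
Coercion contfun_fun : contfun >-> Funclass.

Section contfun.
Context {R : realType} {K : compactHausdorffType}.

HB.instance Definition _ := Choice.copy (contfun R K) (continuousType K R).

Implicit Types f g : contfun R K.

Lemma contfun_continuous f : continuous f.
Proof. exact: (@cts_fun _ _ (f : continuousType K R)). Qed.

Lemma contfunP f g : f =1 g -> f = g.
Proof. by move/continuousEP. Qed.

Definition mkcontfun (f : K -> R) (fc : continuous f) : contfun R K :=
  mkcts fc : continuousType K R.

Lemma mkcontfunE (f : K -> R) (fc : continuous f) x : mkcontfun fc x = f x.
Proof. by []. Qed.

Lemma contfun_add_subproof f g : continuous (fun x => f x + g x).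
Proof. by move=> x; apply: cvgD; exact: contfun_continuous. Qed.

Lemma contfun_opp_subproof f : continuous (fun x => - f x).
Proof. by move=> x; apply: cvgN; exact: contfun_continuous. Qed.

Lemma contfun_scale_subproof (a : R) f : continuous (fun x => a * f x).
Proof. by move=> x; apply: cvgM; [exact: cvg_cst|exact: contfun_continuous]. Qed.

Lemma contfun_modulus_subproof f : continuous (fun x => `|f x|).
Proof. by move=> x; apply: cvg_norm; exact: contfun_continuous. Qed.

Definition contfun_zero : contfun R K := mkcontfun (fun x => cvg_cst (0 : R)).
Definition contfun_add f g := mkcontfun (@contfun_add_subproof f g).
Definition contfun_opp f := mkcontfun (@contfun_opp_subproof f).
Definition contfun_scale a f := mkcontfun (@contfun_scale_subproof a f).

Definition modulus f : contfun R K := mkcontfun (@contfun_modulus_subproof f).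

Lemma contfun_addA : associative contfun_add.
Proof. by move=> f g h; apply: contfunP => x /=; exact: addrA. Qed.

Lemma contfun_addC : commutative contfun_add.
Proof. by move=> f g; apply: contfunP => x /=; exact: addrC. Qed.

Lemma contfun_add0 : left_id contfun_zero contfun_add.
Proof. by move=> f; apply: contfunP => x /=; exact: add0r. Qed.

Lemma contfun_addN : left_inverse contfun_zero contfun_opp contfun_add.
Proof. by move=> f; apply: contfunP => x /=; exact: addNr. Qed.

HB.instance Definition _ := GRing.isZmodule.Build (contfun R K)
  contfun_addA contfun_addC contfun_add0 contfun_addN.

Lemma contfun_scaleA a b f :
  contfun_scale a (contfun_scale b f) = contfun_scale (a * b) f.
Proof. by apply: contfunP => x; exact: mulrA. Qed.

Lemma contfun_scale1 : left_id 1 contfun_scale.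
Proof. by move=> f; apply: contfunP => x; exact: mul1r. Qed.

Lemma contfun_scaleDr : right_distributive contfun_scale +%R.
Proof. by move=> a f g; apply: contfunP => x; exact: mulrDr. Qed.

Lemma contfun_scaleDl f : {morph contfun_scale^~ f : a b / a + b}.
Proof. by move=> a b; apply: contfunP => x; exact: mulrDl. Qed.

HB.instance Definition _ := GRing.Zmodule_isLmodule.Build R (contfun R K)
  contfun_scaleA contfun_scale1 contfun_scaleDr contfun_scaleDl.

Lemma contfun0E x : (0 : contfun R K) x = 0. Proof. by []. Qed.
Lemma contfunDE f g x : (f + g : contfun R K) x = f x + g x. Proof. by []. Qed.
Lemma contfunNE f x : (- f : contfun R K) x = - f x. Proof. by []. Qed.
Lemma contfunBE f g x : (f - g : contfun R K) x = f x - g x. Proof. by []. Qed.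
Lemma contfunZE a f x : (a *: f : contfun R K) x = a * f x. Proof. by []. Qed.
Lemma modulusE f x : modulus f x = `|f x|. Proof. by []. Qed.

(* If [K] is empty, this is [sup set0 = 0]. *)
Definition sup_norm f : R := sup (range (fun x => `|f x|)).

Lemma sup_norm_has_ubound f : has_ubound (range (fun x => `|f x|)).
Proof.
have : compact (range f).
  apply: continuous_compact; last exact: compactT.
  exact/continuous_subspaceT/contfun_continuous.
move=> /compact_bounded[M [_ Mf]]; exists (M + 1) => _ [x _ <-].
by apply: Mf; [rewrite ltrDl|exists x].
Qed.

Lemma sup_norm_ge f x : `|f x| <= sup_norm f.
Proof. by apply: ub_le_sup; [exact: sup_norm_has_ubound|exists x]. Qed.

Lemma sup_norm_le f (M : R) :
  0 <= M -> (forall x, `|f x| <= M) -> sup_norm f <= M.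
Proof.
move=> M0 fM; have [E|/set0P E] := eqVneq (range (fun x => `|f x|)) set0.
  by rewrite /sup_norm E sup0.
by apply: ge_sup => // _ [x _ <-].
Qed.

Lemma sup_norm_ge0 f : 0 <= sup_norm f.
Proof.
have [E|/set0P[_ [x _ _]]] := eqVneq (range (fun x => `|f x|)) set0.
  by rewrite /sup_norm E sup0.
exact: le_trans (normr_ge0 _) (sup_norm_ge f x).
Qed.

Lemma ler_sup_normD f g : sup_norm (f + g) <= sup_norm f + sup_norm g.
Proof.
apply: sup_norm_le => [|x]; first by rewrite addr_ge0// sup_norm_ge0.
by rewrite (le_trans (ler_normD _ _))// lerD// sup_norm_ge.
Qed.

Lemma sup_normZ_le (a : R) f : sup_norm (a *: f) <= `|a| * sup_norm f.
Proof.
apply: sup_norm_le => [|x]; first by rewrite mulr_ge0// sup_norm_ge0.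
by rewrite contfunZE normrM ler_wpM2l// sup_norm_ge.
Qed.

Lemma sup_normZ (a : R) f : sup_norm (a *: f) = `|a| * sup_norm f.
Proof.
apply/eqP; rewrite eq_le sup_normZ_le/=.
have [->|a0] := eqVneq a 0; first by rewrite normr0 mul0r sup_norm_ge0.
rewrite -ler_pdivlMl ?normr_gt0// -normfV.
by rewrite -[X in sup_norm X <= _]scale1r -(mulVf a0) -scalerA sup_normZ_le.
Qed.

Lemma sup_norm0_eq0 f : sup_norm f = 0 -> f = 0.
Proof.
move=> f0; apply: contfunP => x; apply/eqP.
by rewrite -normr_le0 -f0 sup_norm_ge.
Qed.

HB.instance Definition _ := Lmodule_isNormed.Build R (contfun R K)
  ler_sup_normD sup_normZ sup_norm0_eq0.

Lemma contfun_normE f : `|f| = sup (range (fun x => `|f x|)).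
Proof. by []. Qed.

(* The real unimodular scalars are 1 and -1. *)
Definition stable_phase_retrieval_with (C : R) (E : set (contfun R K)) :=
  forall f g, E f -> E g ->
    Num.min `|f - g| `|f + g| <= C * `|modulus f - modulus g|.

Definition stable_phase_retrieval (E : set (contfun R K)) :=
  exists2 C : R, 1 <= C & stable_phase_retrieval_with C E.

End contfun.

(* The ordinals below omega^3 in Cantor normal form: [(c, (b, a))] is
   omega^2 * c + omega * b + a. *)
Definition omega3 : Type := nat *l (nat *l nat).
HB.instance Definition _ := Order.Total.on omega3.

Definition ord_one : omega3 := (0, (0, 1))%N.
Definition ord_omega2 : omega3 := (1, (0, 0))%N.

Definition one_to_omega2 : Type :=
  {b : omega3 | b \in `[ord_one, ord_omega2]%O}.
HB.instance Definition _ := SubChoice.on one_to_omega2.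
Fact one_to_omega2_display : Order.disp_t. Proof. exact: Order.Disp tt tt. Qed.
HB.instance Definition _ :=
  [SubChoice_isSubOrder of one_to_omega2 by <: with one_to_omega2_display].

Definition interval_1_omega2 : Type := order_topology one_to_omega2.
HB.instance Definition _ :=
  OrderTopological.copy interval_1_omega2 (order_topology one_to_omega2).

Lemma omega3_least (P : set omega3) :
  P !=set0 -> exists2 x, P x & forall y, P y -> (x <= y)%O.
Proof.
have nat_least (Q : set nat) : Q !=set0 ->
    exists2 n, Q n & forall m, Q m -> (n <= m)%N.
  move=> [n0 Qn0]; have exQ : exists n, `[< Q n >] by exists n0; exact/asboolP.
  have [n /asboolP Qn nmin] := ex_minnP exQ.
  by exists n => // m Qm; apply: nmin; exact/asboolP.
move=> [[c0 [b0 a0]] P0].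
have [c [b1 [a1 P1]] cmin] := nat_least
  [set c | exists b a, P (c, (b, a))] (ex_intro _ c0 (ex_intro _ b0 (ex_intro _ a0 P0))).
have [b [a2 P2] bmin] := nat_least
  [set b | exists a, P (c, (b, a))] (ex_intro _ b1 (ex_intro _ a1 P1)).
have [a Pa amin] := nat_least [set a | P (c, (b, a))] (ex_intro _ a2 P2).
exists (c, (b, a)) => // -[c' [b' a']] P'.
rewrite Order.ProdLexiOrder.leEprodlexi/= leEnat.
rewrite cmin/=; last by exists b', a'.
apply/implyP => c'c; have {c'c} ec : c' = c.
  by apply/eqP; rewrite eqn_leq c'c cmin//; exists b', a'.
rewrite {c'}ec in P' *.
rewrite Order.ProdLexiOrder.leEprodlexi/= leEnat.
rewrite bmin/=; last by exists a'.
apply/implyP => b'b; have {b'b} eb : b' = b.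
  by apply/eqP; rewrite eqn_leq b'b bmin//; exists a'.
by rewrite {b'}eb in P' *; exact: amin.
Qed.

Lemma interval_1_omega2_least (P : set interval_1_omega2) :
  P !=set0 -> exists2 x, P x & forall y, P y -> (x <= y)%O.
Proof.
move=> [x0 Px0].
have [_ [x Px <-] xmin] := @omega3_least (val @` P) (ex_intro _ _ (imageP val Px0)).
by exists x => // y Py; apply: xmin; exists y.
Qed.

Fact interval_1_omega2_top_subproof : ord_omega2 \in `[ord_one, ord_omega2]%O.
Proof. by []. Qed.

Definition interval_1_omega2_top : interval_1_omega2 :=
  exist _ ord_omega2 interval_1_omega2_top_subproof.

Lemma interval_1_omega2_le_top (x : interval_1_omega2) :
  (x <= interval_1_omega2_top)%O.
Proof. by case: x => x xP; have := xP; rewrite in_itv/= => /andP[]. Qed.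

Lemma interval_1_omega2_compact : compact [set: interval_1_omega2].
Proof.
move=> F PF _; pose ray (x : interval_1_omega2) := [set y | (x < y)%O].
have [x Fx xmin] : exists2 x, ~ F (ray x) & forall y, ~ F (ray y) -> (x <= y)%O.
  apply: (@interval_1_omega2_least [set x | ~ F (ray x)]).
  exists interval_1_omega2_top => /= Ft; apply: (@filter_not_empty _ F).
  by apply: filterS Ft => y /=; rewrite /ray/= ltNge interval_1_omega2_le_top.
exists x; split=> // A B FA; rewrite itv_nbhsE => -[[l r] [lr xlr] lrB].
apply: contrapT => /nonemptyPn AB0; apply: Fx.
have AB y : A y -> y \in Interval l r -> False.
  by move=> Ay /lrB By; have : (A `&` B) y by []; rewrite AB0.
have ltx y : A y -> (l <= BLeft y)%O -> (x < y)%O.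
  move=> Ay ly; rewrite ltNge; apply/negP => yx; apply: (AB y Ay).
  rewrite itv_boundlr ly/=; move: xlr; rewrite itv_boundlr => /andP[_].
  by apply: le_trans; rewrite bnd_simp.
case: l lr xlr ltx {lrB AB} => [b a|b] lr xlr ltx; last first.
  apply: filterS FA => y Ay; apply: ltx => //.
  by move: xlr; rewrite itv_boundlr => /andP[]; case: b {lr}.
have {}b0 : b = false by apply: itv_open_ends_lside lr.
rewrite {}b0 in lr xlr ltx.
have ax : (a < x)%O by move: xlr; rewrite itv_boundlr bnd_simp => /andP[].
have Fa : F (ray a).
  by apply: contrapT => /xmin; rewrite leNgt ax.
by apply: filterS2 FA Fa => y Ay ay; apply: ltx; rewrite ?bnd_simp.
Qed.

HB.instance Definition _ := isCompactHausdorff.Build interval_1_omega2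
  interval_1_omega2_compact order_hausdorff.

(* Main.v *)
From HB Require Import structures.
Require Import Defs.
From mathcomp Require Import all_boot all_order all_algebra.
From mathcomp Require Import all_classical all_reals all_analysis.
From mathcomp Require Import ring lra zify.
Import Order.TTheory GRing.Theory Num.Theory.
Import numFieldNormedType.Exports.

Set Implicit Arguments.
Unset Strict Implicit.
Unset Printing Implicit Defensive.

Local Open Scope classical_set_scope.
Local Open Scope ring_scope.

(** For real scalars [| |a| - |b| | = min(|a - b|, |a + b|)], so stable phase
retrieval of a subspace [E] means that two functions in [E] of norm at least 1
are simultaneously bounded away from 0 at some point.

Arrange [1, omega^2] as a tree of height two: omega^2 is the parent of the limit
ordinals, and a limit ordinal is the parent of the successor ordinals increasing
to it. Subtracting from each value of [f] the value at the parent gives an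
isomorphism from C[1, omega^2] to c_0, and c_0 has a simple stable phase
retrieval embedding: a bump of height [f_i], on which sit infinitely many
smaller bumps of heights [c * f_j], with [j] after [i] and [c = -1, 0, 1]. For
given [f] and [g] with [f_i] and [g_j] large, each function is small on at most
one of the three bumps of the pair [(i, j)]. This needs only infinitely many
non-isolated points, close to one point of K''. Near the other point of K'' the
tree structure yields in the same way an isometric copy of C[1, omega^2], and
the two are joined by a Urysohn function. *)

(** * Families in $c_0$, and series of disjointly supported functions with such coefficients *)

Definition vanishes_at_infinity (R : realType) (I : Type) (a : I -> R) :=
  forall e : R, 0 < e -> finite_set [set i | e <= `|a i|].

Lemma vanishes_comp (R : realType) (I J : Type) (a : I -> R) (u : J -> I) :
  injective u ->
  vanishes_at_infinity a -> vanishes_at_infinity (a \o u).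
Proof.
move=> uI a0 e e0.
apply: (@finite_preimage _ _ [set i | e <= `|a i|] u); last exact: a0.
by move=> ? ? _ _; exact: uI.
Qed.

Section disjoint_sum.
Context {R : realType} {K : topologicalType} {I : choiceType}.
Implicit Types (phi : I -> K -> R) (a b : I -> R).

Definition disjoint_support phi :=
  forall i j x, phi i x != 0 -> phi j x != 0 -> i = j.


(* [\sum_i a i * phi i x], as long as the [phi i] have disjoint supports; otherwise
   one nonzero term of this sum. *)
Definition disjoint_sum phi a (x : K) : R :=
  if pselect (exists i, phi i x != 0) is left e
  then a (projT1 (cid e)) * phi (projT1 (cid e)) x else 0.

Lemma disjoint_sumE phi a i x : disjoint_support phi -> phi i x != 0 ->
  disjoint_sum phi a x = a i * phi i x.
Proof.
move=> dphi ix; rewrite /disjoint_sum; case: pselect => [e|[]]; last by exists i.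
by case: cid => j jx /=; rewrite (dphi _ _ _ ix jx).
Qed.

Lemma disjoint_sum0 phi a x : (forall i, phi i x = 0) -> disjoint_sum phi a x = 0.
Proof.
move=> phi0; rewrite /disjoint_sum; case: pselect => // ex.
by rewrite phi0 mulr0.
Qed.

Lemma disjoint_sumD phi a b x : disjoint_sum phi (fun i => a i + b i) x =
  disjoint_sum phi a x + disjoint_sum phi b x.
Proof.
by rewrite /disjoint_sum; case: pselect => [e|_]; rewrite ?addr0// mulrDl.
Qed.

Lemma disjoint_sumZ phi c a x :
  disjoint_sum phi (fun i => c * a i) x = c * disjoint_sum phi a x.
Proof.
by rewrite /disjoint_sum; case: pselect => [e|_]; rewrite ?mulr0// mulrA.
Qed.

Lemma norm_disjoint_sum_le phi a M x : (forall i, 0 <= phi i x <= 1) ->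
  0 <= M -> (forall i, `|a i| <= M) -> `|disjoint_sum phi a x| <= M.
Proof.
move=> phi01 M0 aM; rewrite /disjoint_sum.
case: pselect => [e|_]; last by rewrite normr0.
set i := projT1 _; have /andP[i0 i1] := phi01 i.
by rewrite normrM (ger0_norm i0) (le_trans _ (aM i))// ler_piMr.
Qed.

(** At a point where some [phi i] is nonzero, the sum is locally the single term of index [i]. At
    any other point, the finitely many terms with [e <= |a i|] are small nearby by continuity, and
    the remaining ones are below [e] everywhere. *)
Lemma disjoint_sum_continuous phi a : disjoint_support phi ->
  (forall i, continuous (phi i)) -> (forall i x, 0 <= phi i x <= 1) ->
  vanishes_at_infinity a -> continuous (disjoint_sum phi a).
Proof.
move=> dphi cphi phi01 a0 x.
have [[i ix]|/forallNP phix] := pselect (exists i, phi i x != 0).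
  have eqx : {near x, (fun y => a i * phi i y) =1 disjoint_sum phi a}.
    have : \forall y \near x, phi i y != 0.
      exact: (cphi i x _ (open_nbhs_nbhs (conj (@open_neq _ _) ix))).
    by apply: filterS => y iy; rewrite (disjoint_sumE _ dphi iy).
  have h : (fun y => a i * phi i y) @ x --> disjoint_sum phi a x.
    rewrite (disjoint_sumE _ dphi ix).
    by apply: cvgM; [exact: cvg_cst|exact: cphi].
  exact: cvg_trans (near_eq_cvg eqx) h.
have phix0 i : phi i x = 0 by apply/eqP/negPn/negP/phix.
rewrite /continuous_at disjoint_sum0//.
apply/cvgr0Pnorm_lt => e e0.
have /finite_fsetP[D DE] := a0 e e0.
have : nbhs x (\bigcap_(i in [set i | e <= `|a i|])
    [set y | `|a i * phi i y| < e]).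
  rewrite DE; apply: filter_bigI => i _.
  have : a i * phi i y @[y --> x] --> a i * phi i x.
    by apply: cvgM; [exact: cvg_cst|exact: cphi].
  by rewrite phix0 mulr0 => /cvgr0Pnorm_lt; exact.
apply: filterS => y Dy.
rewrite /disjoint_sum; case: pselect => [ex|_]; last by rewrite normr0.
set i := projT1 _.
have [ei|] := leP e `|a i|; first by apply: Dy.
apply: le_lt_trans; have /andP[i0 i1] := phi01 i y.
by rewrite normrM (ger0_norm i0) ler_piMr.
Qed.

End disjoint_sum.

(** * Disjoint open sets that all meet a given infinite set *)

Lemma infinite_nbhs_not_isolated (K : topologicalType) (A N : set K) x :
  accessible_space K -> A x -> ~ isolated A x -> nbhs x N ->
  infinite_set (A `&` N).
Proof.
move=> accK Ax isoAx Nx fAN; apply: isoAx; split; first exact/mem_set.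
(* If [A] met [N] in a finite set, [F] would be closed, and removing it from [N] would leave a
   neighbourhood that meets [A] in [x] alone. *)
pose F := (A `&` N) `\ x.
have cF : closed F.
  by apply: (iffLR accessible_finite_set_closed) => //; exact: finite_setD.
exists (N `&` ~` F).
  apply: filterI => //; apply: open_nbhs_nbhs; split; first by rewrite openC.
  by move=> -[_ /(_ erefl)].
apply/seteqP; split=> [y [[Ny Fy] Ay]|_ ->]; last first.
  by split => //; split; [exact: nbhs_singleton|move=> -[_ /(_ erefl)]].
by apply: contrapT => yx; apply: Fy; split.
Qed.

Section disjoint_opens.
Context {K : topologicalType}.
Hypotheses (accK : accessible_space K) (rK : regular_space K).

(** Choose points [x] and [y] of [A] in [O], and a neighbourhood [P] of [x] whose closure misses
    [y]. If the interior of [P] contains infinitely many points of [A] in [O], split off a set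
    around [y]; otherwise split off a smaller set around [x], which leaves almost all of these
    points outside. *)
Lemma split_infinite (A O : set K) : open O -> infinite_set (A `&` O) ->
  exists U O', [/\ open U, U `<=` O, A `&` U !=set0, U `&` O' = set0 &
    [/\ open O', O' `<=` O & infinite_set (A `&` O')]].
Proof.
move=> oO infAO; have [x [Ax Ox]] := infinite_setN0 infAO.
have [y [[Ay Oy] xy]] := infinite_setN0 (infinite_setD infAO (finite_set1 x)).
have disj P : (O `&` P°) `&` (O `&` ~` closure P) = set0.
  apply/seteqP; split=> // z [[_ Pz] [_]]; apply.
  by apply: subset_closure; exact: interior_subset.
have oi P : open (O `&` P°) by apply: openI => //; exact: open_interior.
have oc P : open (O `&` ~` closure P).
  by apply: openI => //; rewrite openC; exact: closed_closure.
have [P xP Py] : exists2 P, nbhs x P & closure P `<=` ~` [set y].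
  apply: rK; apply: open_nbhs_nbhs; split=> [|/esym//].
  by rewrite openC; exact: accessible_closed_set1.
have [finP|infP] := pselect (finite_set (A `&` (O `&` P°))); last first.
  exists (O `&` ~` closure P), (O `&` P°); split=> //.
  - by exists y; do 2?split => //; move=> /Py; exact.
  - by rewrite setIC.
have [P' xP' P'P] : exists2 P', nbhs x P' & closure P' `<=` P°.
  by apply: rK; exact: nbhs_interior.
exists (O `&` P'°), (O `&` ~` closure P'); split=> //.
  by exists x; do 2?split => //; exact: nbhs_singleton (nbhs_interior xP').
split=> //; apply: sub_infinite_set (infinite_setD infAO finP).
move=> z [[Az Oz] Pz]; split=> //; split=> // /P'P Pz'; apply: Pz.
by split.
Qed.

(** Iterates the splitting: [X n] is what remains after [n] steps, and the set split off at step [m]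
    is disjoint from [X m.+1], which contains all later ones. *)
Lemma disjoint_opens (A O : set K) : open O -> infinite_set (A `&` O) ->
  exists U : nat -> set K, [/\ forall n, open (U n), forall n, U n `<=` O,
    forall n, A `&` U n !=set0 & trivIset setT U].
Proof.
move=> oO infAO.
pose T := {O : set K | open O /\ infinite_set (A `&` O)}.
pose P (X : T) (p : set K * T) := [/\ open p.1, p.1 `<=` sval X,
  A `&` p.1 !=set0, p.1 `&` sval p.2 = set0 & sval p.2 `<=` sval X].
have [step stepP] : {step & forall X, P X (step X)}.
  apply: choice => -[X [oX infX]].
  have [U [X' [oU UX AU UX' [oX' X'X infX']]]] := split_infinite oX infX.
  by exists (U, exist _ X' (conj oX' infX')).
pose X n := iter n (fun X => (step X).2) (exist _ O (conj oO infAO) : T).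
have Xle m n : (m <= n)%N -> sval (X n) `<=` sval (X m).
  move=> /subnK <-; elim: (n - m)%N => // k IH.
  by apply: subset_trans IH; have [] := stepP (X (k + m)%N).
exists (fun n => (step (X n)).1); split=> [n|n|n|].
- by have [] := stepP (X n).
- by have [_ UX _ _ _] := stepP (X n); exact: subset_trans UX (Xle 0%N n _).
- by have [] := stepP (X n).
- apply: ltn_trivIset => n m mn.
  apply/seteqP; split=> // z [Um Un].
  have [_ _ _ disj _] := stepP (X m); rewrite -disj; split=> //.
  by apply: (Xle m.+1 n mn); have [_ + _ _ _] := stepP (X n); exact.
Qed.

End disjoint_opens.

Lemma compact_hausdorff_accessible (K : compactHausdorffType) :
  accessible_space K.
Proof. exact: hausdorff_accessible hausdorffT. Qed.

Lemma compact_hausdorff_regular (K : compactHausdorffType) : regular_space K.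
Proof.
by move=> x; apply: (compact_regular hausdorffT compactT); exact: filterT.
Qed.

(** * Bump functions and bumps on top of bumps *)

Section bumps.
Context {R : realType} {K : compactHausdorffType}.
Implicit Types (x : K).

Lemma urysohn_compact (A B : set K) : closed A -> closed B -> A `&` B = set0 ->
  exists f : K -> R, [/\ continuous f, forall x, 0 <= f x <= 1,
    forall x, A x -> f x = 0 & forall x, B x -> f x = 1].
Proof.
move=> cA cB AB0.
have /uniform_separatorP-/(_ R)[f [cf f01 f0 f1]] :=
  iffLR (@normal_separatorP R _) (compact_normal hausdorffT compactT)
    _ _ cA cB AB0.
exists f; split=> // x.
- by have := f01 _ (imageT f x); rewrite /= in_itv.
- by move=> Ax; apply: f0; exists x.
- by move=> Bx; apply: f1; exists x.
Qed.

(** The value 1 is taken on a whole neighbourhood of [x], so that smaller bumps can be placed where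
    this one is constant. *)
Lemma bump (O : set K) x : open O -> O x ->
  exists f : K -> R, [/\ continuous f, forall x, 0 <= f x <= 1,
    forall x, f x != 0 -> O x & nbhs x [set y | f y = 1]].
Proof.
move=> oO Ox.
have [P xP PO] : exists2 P, nbhs x P & closure P `<=` O.
  by apply: compact_hausdorff_regular; exact: open_nbhs_nbhs.
have [|||f [cf f01 f0 f1]] := @urysohn_compact (~` O) (closure P).
- by rewrite closedC.
- exact: closed_closure.
- by rewrite setIC; apply/disjoints_subset; rewrite setCK.
exists f; split=> // [y|].
  by move=> /eqP fy; apply: contrapT => /f0.
by apply: filterS xP => y /subset_closure; exact: f1.
Qed.

Lemma disjoint_bumps (I : countType) (A O : set K) :
  open O -> infinite_set (A `&` O) ->
  exists f : I -> K -> R, [/\ forall i, continuous (f i),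
    forall i x, 0 <= f i x <= 1, disjoint_support f,
    forall i x, f i x != 0 -> O x &
    forall i, exists2 x, A x & nbhs x [set y | f i y = 1]].
Proof.
move=> oO infAO.
have [U [oU UO AU disjU]] :=
  disjoint_opens (@compact_hausdorff_accessible K) (@compact_hausdorff_regular K)
    oO infAO.
have [x xP] := choice AU.
have [f fP] := choice (fun n => bump (oU n) (xP n).2).
exists (f \o pickle); split=> [i|i y|i j y|i y|i] /=.
- by have [] := fP (pickle i).
- by have [] := fP (pickle i).
- have [_ _ fi _] := fP (pickle i); have [_ _ fj _] := fP (pickle j).
  move=> /fi Ui /fj Uj; apply: (pcan_inj (@pickleK I)).
  by apply: disjU => //; exists y.
- by have [_ _ fi _] := fP (pickle i) => /fi /UO.
- exists (x (pickle i)); first by have [] := xP (pickle i).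
  by have [] := fP (pickle i).
Qed.

(** By [inner_outer], the inner bumps over [i] live on the plateau of [f i], where the outer bump
    only adds a constant. *)
Record nested_bumps (I J : countType) (O : set K) (f : I -> K -> R)
    (g : I * J -> K -> R) : Prop := NestedBumps {
  outer_continuous : forall i, continuous (f i);
  outer01 : forall i x, 0 <= f i x <= 1;
  outer_disjoint : disjoint_support f;
  outer_support : forall i x, f i x != 0 -> O x;
  inner_continuous : forall p, continuous (g p);
  inner01 : forall p x, 0 <= g p x <= 1;
  inner_disjoint : disjoint_support g;
  inner_outer : forall p x, g p x != 0 -> f p.1 x = 1;
  inner_peak : forall p, exists x, g p x = 1
}.

Lemma nested_bumps_exist (I J : countType) (O : set K) : open O ->
  infinite_set (cantor_bendixson [set: K] `&` O) ->
  exists (f : I -> K -> R) (g : I * J -> K -> R), nested_bumps O f g.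
Proof.
move=> oO infO; have [f [cf f01 df fO fx]] := disjoint_bumps I oO infO.
pose W i := [set y | f i y = 1]°.
have oW i : open (W i) by exact: open_interior.
have infW i : infinite_set ([set: K] `&` W i).
  (* The plateau of [f i] is a neighbourhood of a non-isolated point, hence infinite: there is room
     for infinitely many inner bumps. *)
  have [x [_ isox] Wx] := fx i.
  apply: (infinite_nbhs_not_isolated _ _ isox) => //.
    exact: compact_hausdorff_accessible.
  exact: nbhs_interior.
have [g gP] := choice (fun i => disjoint_bumps J (oW i) (infW i)).
have gf i j x : g i j x != 0 -> f i x = 1.
  by have [_ _ _ gW _] := gP i; move=> /gW/interior_subset.
exists f, (fun p => g p.1 p.2); split=> //.
- by move=> [i j]; have [] := gP i.
- by move=> [i j] x; have [] := gP i.
- move=> [i j] [i' j'] x /= gx g'x; have ii' : i = i'.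
    by apply: (df _ _ x); rewrite (gf _ _ _ gx, gf _ _ _ g'x) oner_neq0.
  by subst i'; have [_ _ dg _ _] := gP i; rewrite (dg _ _ _ gx g'x).
- by move=> [i j] x; exact: gf.
- move=> [i j].
  by have [_ _ _ _ /(_ j)[x _ /nbhs_singleton gx]] := gP i; exists x.
Qed.

Lemma inner_eq0 (I J : countType) (O : set K) (chi : I -> K -> R)
  (chi2 : I * J -> K -> R) x : nested_bumps O chi chi2 ->
  (forall i, chi i x = 0) -> forall p, chi2 p x = 0.
Proof.
move=> chiP chi0 p; apply/eqP/negPn/negP => /(inner_outer chiP).
by rewrite chi0 => /eqP; rewrite eq_sym oner_eq0.
Qed.

Lemma outer_eq0 (I J : countType) (O : set K) (chi : I -> K -> R)
  (chi2 : I * J -> K -> R) x : nested_bumps O chi chi2 -> ~ O x ->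
  forall i, chi i x = 0.
Proof.
move=> chiP Ox i; apply/eqP/negPn/negP => /(outer_support chiP).
exact: Ox.
Qed.

End bumps.

(** * The ordinals up to $\omega^2$ as nodes of a tree, and their neighbourhoods *)

Definition node_index : countType := option (nat * option nat).

(* [Some (n, o)] stands for the block of ordinals from [omega * n + 1] to
   [omega * n.+1], and [None] for omega^2. *)
Definition ordinal_of (z : node_index) : omega3 :=
  match z with
  | None => ord_omega2
  | Some (n, None) => (0, (n.+1, 0))
  | Some (n, Some m) => (0, (n, m.+1))
  end%N.

Lemma omega3_le (c b a c' b' a' : nat) :
  ((c, (b, a)) <= (c', (b', a')) :> omega3)%O =
  (c < c')%N || (c == c') && ((b < b')%N || (b == b') && (a <= a')%N).
Proof.
by rewrite !Order.ProdLexiOrder.leEprodlexi /= !leEnat; lia.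
Qed.

Lemma ordinal_of_itv z : ordinal_of z \in `[ord_one, ord_omega2]%O.
Proof.
by rewrite in_itv; case: z => [[n [m|]]|]; rewrite /= !omega3_le //=; case: n.
Qed.

Definition node z : interval_1_omega2 := exist _ (ordinal_of z) (ordinal_of_itv z).

Lemma node_surj x : exists z, node z = x.
Proof.
case: x => -[c [b a]] xP; have := xP.
rewrite in_itv/= /ord_one /ord_omega2 !omega3_le => x01.
suff [z zx] : exists z, ordinal_of z = (c, (b, a)) by exists z; exact: val_inj.
case: c b a x01 {xP} => [|c] [|b] [|a] x01; try (exfalso; lia).
- by exists (Some (0, Some a))%N.
- by exists (Some (b, None)).
- by exists (Some (b.+1, Some a)).
- by exists None; case: c x01 => // c x01; exfalso; lia.
Qed.

Lemma node_le z z' : (node z <= node z')%O = (ordinal_of z <= ordinal_of z')%O.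
Proof. by []. Qed.

Lemma node_lt z z' : (node z < node z')%O = ~~ (ordinal_of z' <= ordinal_of z)%O.
Proof. by rewrite ltNge. Qed.

(** The point [y] serves as left end when the basic interval inside [N] is unbounded below. *)
Lemma nbhs_left (x y : interval_1_omega2) (N : set interval_1_omega2) :
  (y < x)%O -> nbhs x N ->
  exists2 l, (l < x)%O & forall z, (l < z <= x)%O -> N z.
Proof.
move=> yx; rewrite itv_nbhsE => -[[l r] [lr xlr] lrN].
have xr : (BRight x <= r)%O by move: xlr; rewrite itv_boundlr => /andP[].
case: l lr xlr lrN => [b a|b] lr xlr lrN; last first.
  exists y => // z /andP[_ zx]; apply: lrN; rewrite /= itv_boundlr.
  rewrite (le_trans _ xr) ?bnd_simp// andbT.
  by move: xlr; rewrite itv_boundlr => /andP[]; case: b {lr}.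
have b0 : b = false by apply: itv_open_ends_lside lr.
rewrite {}b0 in lr xlr lrN.
have ax : (a < x)%O by move: xlr; rewrite itv_boundlr bnd_simp => /andP[].
exists a => // z /andP[az zx]; apply: lrN; rewrite /= itv_boundlr.
by rewrite bnd_simp az /= (le_trans _ xr) ?bnd_simp.
Qed.

Lemma nbhs_top (N : set interval_1_omega2) : nbhs (node None) N ->
  exists n0, forall n o, (n0 <= n)%N -> N (node (Some (n, o))).
Proof.
move=> /(@nbhs_left _ (node (Some (0, None))%N))[] // l.
have [[[n0 o0]|] <-] := node_surj l; last by rewrite ltxx.
move=> _ lN; exists n0.+2 => n o n0n; apply: lN.
by case: o o0 => [m|] [m0|]; rewrite node_lt node_le !omega3_le; lia.
Qed.

Lemma nbhs_limit n (N : set interval_1_omega2) : nbhs (node (Some (n, None))) N ->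
  exists m0, forall m, (m0 <= m)%N -> N (node (Some (n, Some m))).
Proof.
move=> /(@nbhs_left _ (node (Some (n, Some 0)))%N)[].
  by rewrite node_lt !omega3_le; lia.
move=> l; have [[[n0 o0]|] <-] := node_surj l; last first.
  by rewrite node_lt !omega3_le; lia.
case: o0 => [m0|]; rewrite node_lt omega3_le => ln lN.
  exists m0.+1 => m m0m; apply: lN.
  by rewrite node_lt node_le !omega3_le; lia.
(* Here [l] is a limit ordinal at most $\omega n$, hence below the whole block. *)
exists 0%N => m _; apply: lN.
by rewrite node_lt node_le !omega3_le; lia.
Qed.

(** * Increments along the tree: coordinates of $C[1,\omega^2]$ in $c_0$ *)

Section increments.
Context {R : realType}.
Implicit Types (f : contfun R interval_1_omega2) (z : node_index).

Definition parent z : node_index :=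
  if z is Some (n, Some m) then Some (n, None) else None.

(** The root keeps its own value, so [f] at a node is the sum of the increments on the path to the
    root. *)
Definition increment f z : R :=
  if z is None then f (node z) else f (node z) - f (node (parent z)).

Lemma incrementD f g z : increment (f + g) z = increment f z + increment g z.
Proof. by case: z => [[n o]|] //; rewrite /increment !contfunDE addrACA opprD. Qed.

Lemma incrementZ (c : R) f z : increment (c *: f) z = c * increment f z.
Proof. by case: z => [[n o]|] //; rewrite /increment !contfunZE mulrBr. Qed.

Lemma norm_increment_le f z : `|increment f z| <= 2 * `|f|.
Proof.
have fle x : `|f x| <= `|f| := sup_norm_ge f x.
case: z => [[n o]|]; rewrite /increment ?(le_trans (ler_normB _ _))//.
  by rewrite mulr_natl mulr2n lerD.
by rewrite (le_trans (fle _))// ler_peMl ?ler1n.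
Qed.

Lemma near_node f z (e : R) : 0 < e ->
  nbhs (node z) [set y | `|f y - f (node z)| < e].
Proof.
move=> e0; have /cvgrPdist_lt/(_ _ e0) := @contfun_continuous _ _ f (node z).
by apply: filterS => y /=; rewrite distrC.
Qed.

(** By continuity at $\omega^2$, only the blocks [n < n0] can contain increments of size at least
    [e]. In each of these, continuity at the limit ordinal leaves that ordinal and the first [m0 n]
    successors. *)
Lemma increment_vanishes f : vanishes_at_infinity (increment f).
Proof.
move=> e e0; have e20 : 0 < e / 2 by rewrite divr_gt0.
have [n0 n0P] := nbhs_top (near_node f None e20).
have [m0 m0P] := choice (fun n => nbhs_limit (near_node f (Some (n, None)) e0)).
pose s := [seq Some (n, o) | n <- iota 0 n0,
  o <- None :: [seq Some m | m <- iota 0 (m0 n)]] : seq node_index.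
apply: (sub_finite_set _ (finite_seq (None :: s))) => -[[n o]|]; last first.
  by rewrite /= inE eqxx.
rewrite /= inE /= => efz; apply/allpairsPdep.
have nn0 : (n < n0)%N.
  rewrite ltnNge; apply/negP => n0n.
  (* In a late block, a node and its parent both have values within [e / 2] of the value at the
     root. *)
  have h o' : `|f (node (Some (n, o'))) - f (node None)| < e / 2 := n0P n o' n0n.
  move: efz (h o) (h None); rewrite ler_normr !ltr_norml.
  by case: o => [m|] /= /orP[] *; lra.
exists n, o; rewrite mem_iota; split=> //.
case: o efz => [m|] efz; last by rewrite mem_head.
rewrite inE /= mem_map; last by move=> ? ? [].
rewrite mem_iota /= add0n ltnNge; apply/negP => /(m0P n) /=.
by rewrite ltNge efz.
Qed.

(** The path from a node to the root has at most three nodes. *)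
Lemma norm_le_increments f (e : R) : (forall z, `|increment f z| <= e) ->
  `|f| <= 3 * e.
Proof.
move=> fe; have e0 : 0 <= e := le_trans (normr_ge0 _) (fe None).
apply: sup_norm_le => [|x]; first by rewrite mulr_ge0.
have := fe None; have [z <-] := node_surj x.
rewrite /= !ler_norml; case: z => [[n [m|]]|].
- by have := fe (Some (n, None)); have := fe (Some (n, Some m));
    rewrite /= !ler_norml => *; lra.
- by have := fe (Some (n, None)); rewrite /= !ler_norml => *; lra.
- by move=> *; lra.
Qed.

(** The successor ordinals are dense: the bound passes first to the limit ordinals below $\omega^2$,
    then to $\omega^2$. *)
Lemma norm_le_isolated f (e : R) : 0 <= e ->
  (forall n m, `|f (node (Some (n, Some m)))| <= e) -> `|f| <= e.
Proof.
move=> e0 fe.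
have fp n : `|f (node (Some (n, None)))| <= e.
  apply/ler_addgt0Pr => d d0.
  have [m0 /(_ m0 (leqnn _)) /=] := nbhs_limit (near_node f (Some (n, None)) d0).
  by have := fe n m0; rewrite !ler_norml ltr_norml => *; lra.
apply: sup_norm_le => // x; have [z <-] := node_surj x.
case: z => [[n [m|]]|] //.
apply/ler_addgt0Pr => d d0.
have [n0 /(_ n0 None (leqnn _)) /=] := nbhs_top (near_node f None d0).
by have := fp n0; rewrite !ler_norml ltr_norml => *; lra.
Qed.

(** The coefficients 0, 1, -1 are [None], [Some false], [Some true]. *)
Definition sign_coef (s : option bool) : R := if s is Some b then (-1) ^+ b else 0.

(** Nodes are ordered by their codes. Dropping the pairs whose second node comes earlier makes the
    family vanish at infinity; equal nodes are kept, since two functions may be large at the same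
    node. *)
Definition pair_coef f (p : node_index * (node_index * option bool)) : R :=
  if (pickle p.1 <= pickle p.2.1)%N then sign_coef p.2.2 * increment f p.2.1
  else 0.

Lemma norm_sign_coef_le1 s : `|sign_coef s| <= 1.
Proof. by case: s => [b|] /=; rewrite ?normrX ?normrN ?normr1 ?expr1n ?normr0. Qed.

Lemma norm_pair_coef_le f p : `|pair_coef f p| <= `|increment f p.2.1|.
Proof.
rewrite /pair_coef; case: ifP; rewrite ?normr0// normrM => _.
by rewrite ler_piMl// norm_sign_coef_le1.
Qed.

Lemma pair_coefD f g p : pair_coef (f + g) p = pair_coef f p + pair_coef g p.
Proof. by rewrite /pair_coef; case: ifP; rewrite ?addr0// incrementD mulrDr. Qed.

Lemma pair_coefZ (c : R) f p : pair_coef (c *: f) p = c * pair_coef f p.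
Proof. by rewrite /pair_coef; case: ifP; rewrite ?mulr0// incrementZ mulrCA. Qed.

(** Only finitely many [w] have a large increment, and each is paired with finitely many [z] of
    smaller or equal code and three signs. *)
Lemma pair_coef_vanishes f : vanishes_at_infinity (pair_coef f).
Proof.
move=> e e0.
pose s w := [seq (z, (w, o)) | z <- pmap unpickle (iota 0 (pickle w).+1),
  o <- enum {: option bool}] : seq (node_index * (node_index * option bool)).
apply: (@sub_finite_set _ _
  (\bigcup_(w in [set w | e <= `|increment f w|]) [set` s w])).
  move=> [z [w o]] /= ep; exists w.
    exact: le_trans ep (norm_pair_coef_le _ _).
  apply/allpairsP; exists (z, o); split=> //; last by rewrite mem_enum.
  rewrite mem_pmap; apply/mapP; exists (pickle z); rewrite ?pickleK// mem_iota ltnS.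
  by move: ep; rewrite /pair_coef /=; case: ifP => // _; rewrite normr0 leNgt e0.
by apply: bigcup_finite => [|w _]; [exact: increment_vanishes|exact: finite_seq].
Qed.

End increments.

(** * The embedding: its isometry and its overlap estimate *)

Section embedding.
Context {R : realType} {K : compactHausdorffType}.
Context (h : K -> R) (O1 O0 : set K).
Context (phi : nat -> K -> R) (phi2 : nat * nat -> K -> R).
Context (psi : node_index -> K -> R)
  (psi2 : node_index * (node_index * option bool) -> K -> R).
Hypotheses (ch : continuous h) (h01 : forall x, 0 <= h x <= 1)
  (hO1 : forall x, O1 x -> h x = 1) (hO0 : forall x, O0 x -> h x = 0)
  (phiP : nested_bumps O1 phi phi2) (psiP : nested_bumps O0 psi psi2).
Implicit Types f g : contfun R interval_1_omega2.

Let limit_increment f n := increment f (Some (n, None)).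
Let isolated_increment f (p : nat * nat) := increment f (Some (p.1, Some p.2)).

(** The first three terms rebuild [f] along the tree on [O1], with [h] switching off the value at
    the root towards [O0]. The last term is the $c_0$ construction on [O0]; each of its two sums is
    bounded by twice the norm of [f], whence the factor 1/4. *)
Definition embedding_fun f (x : K) : R :=
  f (node None) * h x + disjoint_sum phi (limit_increment f) x
  + disjoint_sum phi2 (isolated_increment f) x
  + 4^-1 *
    (disjoint_sum psi (increment f) x + disjoint_sum psi2 (pair_coef f) x).

Lemma embedding_continuous f : continuous (embedding_fun f).
Proof.
have [cphi phi01 dphi _ cphi2 phi201 dphi2 _ _] := phiP.
have [cpsi psi01 dpsi _ cpsi2 psi201 dpsi2 _ _] := psiP.
have incr0 := increment_vanishes f.
have c1 : continuous (fun x => f (node None) * h x).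
  by move=> x; apply: cvgM; [exact: cvg_cst|exact: ch].
have c2 : continuous (disjoint_sum phi (limit_increment f)).
  by apply: disjoint_sum_continuous => //; apply: vanishes_comp incr0 => n m [].
have c3 : continuous (disjoint_sum phi2 (isolated_increment f)).
  apply: disjoint_sum_continuous => //.
  by apply: vanishes_comp incr0 => -[n m] [n' m'] /= [-> ->].
have c4 : continuous (disjoint_sum psi (increment f)).
  exact: disjoint_sum_continuous.
have c5 : continuous (disjoint_sum psi2 (pair_coef f)).
  by apply: disjoint_sum_continuous => //; exact: pair_coef_vanishes.
move=> x; apply: (cvgD (cvgD (cvgD (c1 x) (c2 x)) (c3 x))).
exact: cvgM (cvg_cst _) (cvgD (c4 x) (c5 x)).
Qed.

Definition embedding f : contfun R K := mkcontfun (@embedding_continuous f).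

Lemma embedding_linear : linear embedding.
Proof.
move=> c f g; apply: contfunP => x.
rewrite contfunDE contfunZE !mkcontfunE /embedding_fun.
have E (I : choiceType) (chi : I -> K -> R)
    (a : contfun R interval_1_omega2 -> I -> R) :
    (forall f g i, a (f + g) i = a f i + a g i) ->
    (forall c f i, a (c *: f) i = c * a f i) ->
    disjoint_sum chi (a (c *: f + g)) x =
    c * disjoint_sum chi (a f) x + disjoint_sum chi (a g) x.
  move=> aD aZ; rewrite -disjoint_sumZ -disjoint_sumD; congr disjoint_sum.
  by apply/funext => i; rewrite aD aZ.
rewrite !E ?contfunDE ?contfunZE.
all: try by move=> *; rewrite /limit_increment /isolated_increment
  ?incrementD ?incrementZ ?pair_coefD ?pair_coefZ.
by ring.
Qed.

Lemma embedding_O1 f x : O1 x -> embedding f x =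
  f (node None) + disjoint_sum phi (limit_increment f) x
  + disjoint_sum phi2 (isolated_increment f) x.
Proof.
move=> Ox; have xO0 : ~ O0 x.
  by move=> /hO0; rewrite hO1// => /eqP; rewrite oner_eq0.
have psi0 := outer_eq0 psiP xO0.
rewrite mkcontfunE /embedding_fun hO1// mulr1.
rewrite (disjoint_sum0 _ psi0) (disjoint_sum0 _ (inner_eq0 psiP psi0)).
by rewrite addr0 mulr0 addr0.
Qed.

Lemma embedding_notO1 f x : ~ O1 x -> embedding f x =
  f (node None) * h x +
  4^-1 * (disjoint_sum psi (increment f) x + disjoint_sum psi2 (pair_coef f) x).
Proof.
move=> Ox; have phi0 := outer_eq0 phiP Ox.
rewrite mkcontfunE /embedding_fun.
by rewrite (disjoint_sum0 _ phi0) (disjoint_sum0 _ (inner_eq0 phiP phi0)) !addr0.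
Qed.

(** On the plateau of [phi p.1] the increments telescope, and the value interpolates between those
    of [f] at a successor ordinal and at its parent. *)
Lemma embedding_isolated f p x : phi2 p x != 0 -> embedding f x =
  f (node (Some (p.1, None))) +
  (f (node (Some (p.1, Some p.2))) - f (node (Some (p.1, None)))) * phi2 p x.
Proof.
move=> px; have phi1 := inner_outer phiP px.
have phin0 : phi p.1 x != 0 by rewrite phi1 oner_neq0.
rewrite embedding_O1; last exact: (outer_support phiP phin0).
rewrite (disjoint_sumE _ (outer_disjoint phiP) phin0).
rewrite (disjoint_sumE _ (inner_disjoint phiP) px).
by rewrite phi1 mulr1 /limit_increment /isolated_increment /= subrKC.
Qed.

Lemma embedding_pair f z w s x : psi2 (z, (w, s)) x = 1 ->
  (pickle z <= pickle w)%N ->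
  embedding f x = 4^-1 * (increment f z + sign_coef s * increment f w).
Proof.
move=> px zw; have pxn0 : psi2 (z, (w, s)) x != 0 by rewrite px oner_neq0.
have psi1 := inner_outer psiP pxn0; rewrite /= in psi1.
have psin0 : psi z x != 0 by rewrite psi1 oner_neq0.
have xO0 := outer_support psiP psin0.
rewrite embedding_notO1; last first.
  by move=> /hO1; rewrite hO0// => /esym/eqP; rewrite oner_eq0.
rewrite hO0// mulr0 add0r (disjoint_sumE _ (outer_disjoint psiP) psin0).
rewrite (disjoint_sumE _ (inner_disjoint psiP) pxn0).
by rewrite psi1 px !mulr1 /pair_coef /= zw.
Qed.

Lemma norm_convex_le (M a b t : R) : 0 <= t <= 1 -> `|a| <= M -> `|b| <= M ->
  `|a + (b - a) * t| <= M.
Proof.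
move=> /andP[t0 t1]; rewrite !ler_norml => /andP[a1 a2] /andP[b1 b2].
by apply/andP; split; nra.
Qed.

(** On [O1] the values are convex combinations of values of [f], on [O0] the bound is $(2+2)/4$
    times the norm, and elsewhere only [f (node None) * h x] remains. *)
Lemma norm_embedding_le f : `|embedding f| <= `|f|.
Proof.
have fle z : `|f z| <= `|f| := sup_norm_ge f z.
apply: sup_norm_le => // x.
have [[p px]|/forallNP phi2x] := pselect (exists p, phi2 p x != 0).
  by rewrite (embedding_isolated _ px) norm_convex_le// (inner01 phiP).
have phi20 p : phi2 p x = 0 by apply/eqP/negPn/negP/phi2x.
have [xO1|xO1] := pselect (O1 x).
  rewrite embedding_O1// (disjoint_sum0 _ phi20) addr0.
  have [[n nx]|/forallNP phix] := pselect (exists n, phi n x != 0).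
    rewrite (disjoint_sumE _ (outer_disjoint phiP) nx).
    by rewrite norm_convex_le// (outer01 phiP).
  by rewrite disjoint_sum0 ?addr0// => n; apply/eqP/negPn/negP/phix.
rewrite embedding_notO1//.
have [xO0|xO0] := pselect (O0 x).
  rewrite hO0// mulr0 add0r normrM ger0_norm ?invr_ge0//.
  have h1 : `|disjoint_sum psi (increment f) x| <= 2 * `|f|.
    apply: norm_disjoint_sum_le => [i||i]; first exact: outer01 psiP _ _.
      by rewrite mulr_ge0.
    exact: norm_increment_le.
  have h2 : `|disjoint_sum psi2 (pair_coef f) x| <= 2 * `|f|.
    apply: norm_disjoint_sum_le => [i||i]; first exact: inner01 psiP _ _.
      by rewrite mulr_ge0.
    exact: le_trans (norm_pair_coef_le _ _) (norm_increment_le _ _).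
  have := ler_normD (disjoint_sum psi (increment f) x)
    (disjoint_sum psi2 (pair_coef f) x).
  by move=> *; lra.
have psi0 := outer_eq0 psiP xO0.
rewrite (disjoint_sum0 _ psi0) (disjoint_sum0 _ (inner_eq0 psiP psi0)).
have /andP[h0 h1] := h01 x.
rewrite addr0 mulr0 addr0 normrM (ger0_norm h0).
by rewrite (le_trans _ (fle (node None)))// ler_piMr.
Qed.

Lemma norm_embedding f : `|embedding f| = `|f|.
Proof.
apply/eqP; rewrite eq_le norm_embedding_le /=.
apply: norm_le_isolated => // n m.
(* At this peak the image takes exactly the value of [f] at the successor ordinal. *)
have [x px] := inner_peak phiP (n, m).
apply: le_trans (sup_norm_ge _ x).
rewrite (@embedding_isolated _ (n, m)) px ?oner_neq0//= mulr1.
by rewrite subrKC.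
Qed.

(** If both norms exceed [36 * M], each function has an increment above [12 * M], and one of the
    three bumps of the corresponding pair of nodes makes both images exceed [M]. *)
Lemma embedding_overlap f g (M : R) :
  (forall x, Num.min `|embedding f x| `|embedding g x| <= M) ->
  Num.min `|f| `|g| <= 36 * M.
Proof.
move=> fgM; rewrite leNgt lt_min; apply/negP => /andP[fM gM].
have large u : 36 * M < `|u| -> exists z, 12 * M < `|increment u z|.
  move=> uM; apply: contrapT => /forallNP uz.
  suff : `|u| <= 3 * (12 * M) by move: uM => *; lra.
  by apply: norm_le_increments => z; rewrite leNgt; apply/negP/uz.
have overlap u v : (forall x, Num.min `|embedding u x| `|embedding v x| <= M) ->
    forall z w, (pickle z <= pickle w)%N -> 12 * M < `|increment u z| ->
    12 * M < `|increment v w| -> False.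
  move=> uvM z w zw uz vw.
  (* The factor 1/4 in the embedding turns the bound [M] into [4 * M]. *)
  have peak s : `|increment u z + sign_coef s * increment u w| <= 4 * M \/
      `|increment v z + sign_coef s * increment v w| <= 4 * M.
    have [x px] := inner_peak psiP (z, (w, s)).
    have := uvM x; rewrite !(embedding_pair _ px zw) ge_min !normrM.
    rewrite ger0_norm ?invr_ge0// => /orP[] *; [left|right]; lra.
  (* Two of the three coefficients are bad for the same function, say [u]: then
     [|increment u w| <= 8 * M] and [|increment u z| <= 12 * M]. *)
  have := peak None; have := peak (Some true); have := peak (Some false).
  rewrite /= expr0 expr1 mul0r addr0 mul1r mulN1r !ler_norml.
  move: uz vw; rewrite !ltr_normr.
  by move=> /orP[] ? /orP[] ? [] /andP[? ?] [] /andP[? ?] [] /andP[? ?]; lra.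
have [z uz] := large f fM; have [w vw] := large g gM.
(* The node with the smaller code must be the outer one; the roles of [f] and [g] are exchanged if
   necessary. *)
have [zw|/ltnW wz] := leqP (pickle z) (pickle w).
  exact: overlap fgM _ _ zw uz vw.
by apply: (overlap g f) wz vw uz => x; rewrite minC.
Qed.

End embedding.

(** * Two points of $K''$ and the conclusion *)

Lemma card_ge2 (T : Type) (A : set T) : (`I_2 #<= A)%card ->
  exists x y, [/\ A x, A y & x <> y].
Proof.
move=> /card_leP[f].
have I0 : `I_2 0%N by []. have I1 : `I_2 1%N by [].
pose i0 : set_type `I_2 := SigSub (mem_set I0).
pose i1 : set_type `I_2 := SigSub (mem_set I1).
exists (val (f i0)), (val (f i1)); split; [exact: set_valP|exact: set_valP|].
by move=> /val_inj /(@inj _ _ _ f) h; have : i0 = i1 by apply: h; rewrite inE.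
Qed.

Lemma min_dist_le_dist_norm (R : realDomainType) (a b : R) :
  Num.min `|a - b| `|a + b| <= `| `|a| - `|b| |.
Proof.
rewrite ge_min; have [a0|a0] := ler0P a; have [b0|b0] := ler0P b.
- by rewrite -opprD normrN lexx.
- by rewrite -opprD normrN lexx orbT.
- by rewrite opprK lexx orbT.
- by rewrite lexx.
Qed.

Theorem theorem4p6 (R : realType) (K : compactHausdorffType)
    (hK : (`I_2 #<= cantor_bendixson (cantor_bendixson [set: K]))%card) :
  exists T : {linear contfun R interval_1_omega2 -> contfun R K},
    (forall f, `|T f| = `|f|) /\ stable_phase_retrieval (range T).
Proof.
have [a [b [[aK' isoa] [bK' isob] ab]]] := card_ge2 hK.
have accK := @compact_hausdorff_accessible K.
have inf O x : cantor_bendixson [set: K] x ->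
    ~ isolated (cantor_bendixson [set: K]) x -> open O -> O x ->
    infinite_set (cantor_bendixson [set: K] `&` O).
  move=> xK' isox oO Ox; apply: (infinite_nbhs_not_isolated accK xK' isox).
  exact: open_nbhs_nbhs.
have [h [ch h01 h0 h1]] : exists h : K -> R, [/\ continuous h,
    forall x, 0 <= h x <= 1, nbhs b [set x | h x = 0] & nbhs a [set x | h x = 1]].
  have [P aP Pb] : exists2 P, nbhs a P & closure P `<=` ~` [set b].
    apply: compact_hausdorff_regular.
    apply: open_nbhs_nbhs; split=> //.
    by rewrite openC; exact: accessible_closed_set1.
  (* Neighbourhoods with disjoint closures make [h] constant near both points, not only at them. *)
  have [Q bQ QP] : exists2 Q, nbhs b Q & closure Q `<=` ~` closure P.
    apply: compact_hausdorff_regular.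
    apply: open_nbhs_nbhs; split=> [|/Pb]; last exact.
    by rewrite openC; exact: closed_closure.
  have [|||h [ch h01 h0 h1]] := @urysohn_compact R K (closure Q) (closure P).
  - exact: closed_closure.
  - exact: closed_closure.
  - exact/disjoints_subset.
  exists h; split=> //.
  - by apply: filterS bQ => x /subset_closure; exact: h0.
  - by apply: filterS aP => x /subset_closure; exact: h1.
(* [O1] and [O0] are the interiors of the level sets of [h] at 1 and 0. They contain [a] and [b],
   which are non-isolated in $K'$, so each meets $K'$ in an infinite set. *)
have [phi [phi2 phiP]] := @nested_bumps_exist R K nat nat _ (open_interior _)
  (inf _ _ aK' isoa (open_interior _) h1).
have [psi [psi2 psiP]] := @nested_bumps_exist R K node_index
  (node_index * option bool)%type _ (open_interior _)
  (inf _ _ bK' isob (open_interior _) h0).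
have hO1 x : [set x | h x = 1]° x -> h x = 1 by move=> /interior_subset.
have hO0 x : [set x | h x = 0]° x -> h x = 0 by move=> /interior_subset.
pose T0 := embedding ch phiP psiP.
pose T : {linear contfun R interval_1_omega2 -> contfun R K} :=
  HB.pack T0
    (GRing.isLinear.Build R _ _ *:%R T0 (embedding_linear ch phiP psiP)).
exists T; split; first exact: (norm_embedding ch h01 hO1 hO0 phiP psiP).
exists 36; first by rewrite ler1n.
move=> _ _ [f _ <-] [g _ <-].
rewrite -raddfB -raddfD.
have normT u : `|T u| = `|u| := norm_embedding ch h01 hO1 hO0 phiP psiP u.
(* The overlap estimate is applied to [f - g] and [f + g], with [M] the norm of the difference of
   the moduli of [T f] and [T g]. *)
rewrite !normT; apply: (embedding_overlap (ch := ch) hO1 hO0 (phiP := phiP)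
  (psiP := psiP)) => x.
have -> : embedding ch phiP psiP (f - g) = T f - T g := raddfB T f g.
have -> : embedding ch phiP psiP (f + g) = T f + T g := raddfD T f g.
rewrite contfunBE contfunDE.
apply: le_trans (min_dist_le_dist_norm _ _) _.
exact: (sup_norm_ge (modulus (T f) - modulus (T g)) x).
Qed.
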